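(* Let $M$ be a Riemannian manifold. For all functions $f_{1}, f_{2}:M\to(-\infty,\infty]$ and $p\in M$, we have $$D^{-}f_{1}(p)+D^{-}f_{2}(p)\subseteq D^{-}(f_{1}+f_{2})(p),$$ and analogously $D^{+}f_{1}(p)+D^{+}f_{2}(p)\subseteq D^{+}(f_{1}+f_{2})(p)$.
   Context: A Riemannian manifold is a $C^\infty$ manifold modelled on a Hilbert space (possibly infinite-dimensional) with a $C^\infty$ assignment of scalar products on the tangent spaces inducing equivalent norms. For $f:M\to(-\infty,\infty]$ and $p$ with $f(p)<\infty$, $D^{-}f(p)\subset T^*M_p$ is the set of all $d\varphi(p)$ with $\varphi\in C^1(M,\mathbb{R})$ such that $f-\varphi$ attains a local minimum at $p$, and $D^{+}f(p)$ is the set of all $d\varphi(p)$ with $\varphi\in C^1(M,\mathbb{R})$ such that $f-\varphi$ attains a local maximum at $p$; these sets are empty when $f(p)=\infty$. The sum of two subsets is the Minkowski sum $A+B=\{a+b:a\in A,b\in B\}$ (empty if $A$ or $B$ is empty). *)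

(* Defs.v *)
From HB Require Import structures.
From mathcomp Require Import all_boot all_order all_algebra.
From mathcomp Require Import sesquilinear ring.
From mathcomp Require Import all_classical all_reals all_analysis.

Set Implicit Arguments.
Unset Strict Implicit.
Unset Printing Implicit Defensive.

Import Order.TTheory GRing.Theory Num.Theory.
Import numFieldNormedType.Exports.

Local Open Scope classical_set_scope.
Local Open Scope ring_scope.

Section ContinuousLinearMaps.
Context {R : realType} {E F : normedModType R}.

Definition clin_pred : {pred E -> F} :=
  [pred f : E -> F | `[< linear f /\ continuous f >]].

Record clin := Clin { clin_fun :> E -> F; clin_funP : clin_fun \in clin_pred }.

HB.instance Definition _ := [isSub for clin_fun].
HB.instance Definition _ := [Choice of clin by <:].

Fact clin_submod_closed : submod_closed clin_pred.
Proof.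
split=> [|a f g].
  apply/asboolP; split=> [k x y|]; last exact: cst_continuous.
  by rewrite scaler0 addr0.
move=> /asboolP[lf cf] /asboolP[lg cg]; apply/asboolP.
rewrite (_ : a *: f + g = fun x => a *: f x + g x)//; split=> [k x y|x].
  by rewrite lf lg !scalerDr addrACA !scalerA [a * k]mulrC.
by apply: cvgD; [apply: cvgZr; exact: cf|exact: cg].
Qed.
HB.instance Definition _ :=
  GRing.isSubmodClosed.Build R (E -> F) clin_pred clin_submod_closed.
HB.instance Definition _ := [SubChoice_isSubLmodule of clin by <:].

Lemma clin_linear (f : clin) : linear f.
Proof. by have /asboolP[] := clin_funP f. Qed.

Lemma clin_continuous (f : clin) : continuous f.
Proof. by have /asboolP[] := clin_funP f. Qed.

Definition clin_norm (f : clin) : R :=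
  sup [set `|f x| | x in [set x | `|x| <= 1]].

Lemma clin0 (f : clin) : f 0 = 0.
Proof.
by have := clin_linear f (-1) 0 0; rewrite !scaleN1r oppr0 addr0 addNr.
Qed.

Lemma clinZ (f : clin) (a : R) (x : E) : f (a *: x) = a *: f x.
Proof. by have := clin_linear f a x 0; rewrite clin0 !addr0. Qed.

Lemma clin_has_sup (f : clin) : has_sup [set `|f x| | x in [set x | `|x| <= 1]].
Proof.
split; first by exists `|f 0|, 0 => //=; rewrite normr0.
have /cvgrPdist_le/(_ 1 ltr01) := @clin_continuous f 0.
move=> /nbhs_norm0P[e /= e0 He].
exists (2 / e) => _ [x /= x1 <-].
have /= := He ((e / 2) *: x); rewrite clin0 sub0r normrN clinZ !normrZ.
have e2 : 0 < e / 2 by rewrite divr_gt0.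
rewrite -normrM gtr0_norm// -[2 / e]mulr1 -[2 / e]invf_div ler_pdivlMl//.
apply; rewrite (@le_lt_trans _ _ (e / 2))// ?ler_piMr ?(ltW e2)//.
by rewrite gtr_pMr// invf_lt1 ?ltr1n.
Qed.

Lemma clin_norm_ge (f : clin) (x : E) : `|f x| <= clin_norm f * `|x|.
Proof.
have [->|x0] := eqVneq x 0; first by rewrite clin0 !normr0 mulr0.
have nx : 0 < `|x| by rewrite normr_gt0.
rewrite -ler_pdivrMr// mulrC -[X in X * _]gtr0_norm ?invr_gt0// -normrZ -clinZ.
apply: sup_upper_bound; first exact: clin_has_sup.
exists (`|x|^-1 *: x) => //=.
by rewrite normrZ gtr0_norm ?invr_gt0// mulVf// gt_eqF.
Qed.

Lemma clin_norm_le (f : clin) (M : R) :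
  (forall x, `|x| <= 1 -> `|f x| <= M) -> clin_norm f <= M.
Proof.
move=> fM; apply: ge_sup; first by case: (clin_has_sup f).
by move=> _ [x /= x1 <-]; exact: fM.
Qed.

Fact clin_norm_ge0 (f : clin) : 0 <= clin_norm f.
Proof.
apply: sup_upper_bound; first exact: clin_has_sup.
by exists 0; rewrite /= ?clin0 normr0.
Qed.

Lemma clin_norm_le1 (f : clin) (x : E) : `|x| <= 1 -> `|f x| <= clin_norm f.
Proof. by move=> x1; apply: sup_upper_bound; [exact: clin_has_sup|exists x]. Qed.

Fact ler_clin_normD (f g : clin) : clin_norm (f + g) <= clin_norm f + clin_norm g.
Proof.
apply: clin_norm_le => x x1; apply: (le_trans (ler_normD _ _)).
by apply: lerD; exact: clin_norm_le1.
Qed.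

Fact clin_normZ (a : R) (f : clin) : clin_norm (a *: f) = `|a| * clin_norm f.
Proof.
have le b g : clin_norm (b *: g) <= `|b| * clin_norm g.
  apply: clin_norm_le => x x1; rewrite [leLHS]normrZ.
  by apply: ler_wpM2l => //; exact: clin_norm_le1.
apply/eqP; rewrite eq_le le /=.
have [->|a0] := eqVneq a 0; first by rewrite normr0 mul0r clin_norm_ge0.
rewrite -ler_pdivlMl ?normr_gt0// -normfV.
by apply: le_trans (le _ _); rewrite scalerA mulVf// scale1r.
Qed.

Fact clin_norm0_eq0 (f : clin) : clin_norm f = 0 -> f = 0.
Proof.
move=> f0; apply: val_inj; apply/funext => x /=.
apply/eqP; rewrite -normr_le0.
by have := clin_norm_ge f x; rewrite f0 mul0r.
Qed.

HB.instance Definition _ :=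
  Lmodule_isNormed.Build R clin ler_clin_normD clin_normZ clin_norm0_eq0.

End ContinuousLinearMaps.
Arguments clin {R} E F.

Section DotNorm.
Context {R : realType} {U : lmodType R} (g : {dot U for idfun}).
Implicit Types u v w : U.

Definition dot_norm v : R := Num.sqrt (g v v).

Fact dotC v w : g v w = g w v.
Proof. by rewrite [LHS](@hermitian_subproof _ _ _ _ g) expr0 mul1r. Qed.

Fact dotDr u v w : g u (v + w) = g u v + g u w.
Proof. exact: linearDr. Qed.

Fact dot0r u : g u 0 = 0.
Proof. exact: linear0r. Qed.

Fact dotD v w : g (v + w) (v + w) = g v v + 2 * g v w + g w w.
Proof.
by rewrite !dotDr ![g (v + w) _]dotC !dotDr (dotC w v) mulr_natl mulr2n !addrA.
Qed.

Fact dotZr a v w : g v (a *: w) = a * g v w.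
Proof. exact: linearZr_LR. Qed.

Fact dotZl a v w : g (a *: v) w = a * g v w.
Proof. by rewrite dotC dotZr dotC. Qed.

Fact dot_ge0 v : 0 <= g v v.
Proof.
have [->|v0] := eqVneq v 0; first by rewrite dot0r.
exact/ltW/neq0_dnorm_gt0.
Qed.

Fact dot_cauchy_schwarz v w : g v w <= dot_norm v * dot_norm w.
Proof.
rewrite -sqrtrM ?dot_ge0//; apply: (le_trans (ler_norm _)).
rewrite -sqrtr_sqr ler_wsqrtr//.
have [->|w0] := eqVneq w 0; first by rewrite !dot0r expr0n mulr0.
have gw := @neq0_dnorm_gt0 _ _ _ g _ w0.
rewrite -subr_ge0 -(pmulr_rge0 _ gw).
have := dot_ge0 (g w w *: v + (- g v w) *: w); rewrite dotD !dotZl !dotZr.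
by move: (g v v) (g v w) (g w w) => a b c; congr (_ <= _); ring.
Qed.

Fact ler_dot_normD v w : dot_norm (v + w) <= dot_norm v + dot_norm w.
Proof.
rewrite -[leRHS]ger0_norm ?addr_ge0 ?sqrtr_ge0// -sqrtr_sqr ler_wsqrtr//.
rewrite dotD sqrrD !sqr_sqrtr ?dot_ge0// lerD2r lerD2l -[leRHS]mulr_natl.
rewrite ler_pM2l//; exact: dot_cauchy_schwarz.
Qed.

Fact dot_normZ (a : R) v : dot_norm (a *: v) = `|a| * dot_norm v.
Proof.
by rewrite /dot_norm dotZl dotZr mulrA -expr2 sqrtrM ?sqr_ge0// sqrtr_sqr.
Qed.

Fact dot_norm0_eq0 v : dot_norm v = 0 -> v = 0.
Proof.
move/eqP; apply: contraTeq => v0.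
by rewrite gt_eqF// sqrtr_gt0 neq0_dnorm_gt0.
Qed.

End DotNorm.

(* The default value 0 is only used where the differential is not continuous,
   hence never at a point of differentiability. *)
Definition fderiv {R : realType} {E F : normedModType R} (f : E -> F) (x : E) :
  clin E F := insubd 0 ('d f x : E -> F).

(* C^k on an open set [U]; the derivative takes its values in L(E, F), which
   carries the operator norm. *)
Fixpoint Ck {R : realType} {E : normedModType R} (k : nat)
    {F : normedModType R} (U : set E) (f : E -> F) : Prop :=
  match k with
  | 0 => forall x, U x -> {for x, continuous f}
  | k'.+1 => (forall x, U x -> differentiable f x) /\ Ck k' U (fderiv f)
  end.

Definition Cinfty {R : realType} {E F : normedModType R} (U : set E)
  (f : E -> F) : Prop := forall k, Ck k U f.

Record hilbertType (R : realType) := HilbertType {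
  hilbert_sort :> completeNormedModType R;
  inner : {dot hilbert_sort for idfun};
  inner_norm : forall x, `|x| ^+ 2 = inner x x
}.

(* A homeomorphism from the open set [cdom] onto the open set [cimg]; the values
   of [cmap] outside [cdom] and of [cinv] outside [cimg] are irrelevant. *)
Record chart (T : topologicalType) (R : realType) (H : normedModType R) := Chart {
  cdom : set T;
  cimg : set H;
  cmap :> T -> H;
  cinv : H -> T;
  cdom_open : open cdom;
  cimg_open : open cimg;
  cmap_fun : forall p, cdom p -> cimg (cmap p);
  cinv_fun : forall x, cimg x -> cdom (cinv x);
  cmapK : forall p, cdom p -> cinv (cmap p) = p;
  cinvK : forall x, cimg x -> cmap (cinv x) = x;
  cmap_continuous : forall p, cdom p -> {for p, continuous cmap};
  cinv_continuous : forall x, cimg x -> {for x, continuous cinv}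
}.

(* No separation axiom is imposed; any atlas is allowed, not only maximal ones. *)
Record hilbertManifold (R : realType) (H : hilbertType R) := HilbertManifold {
  manifold_sort :> topologicalType;
  atlas : set (chart manifold_sort H);
  atlas_cover : forall p, exists2 c, atlas c & cdom c p;
  atlas_smooth : forall c d, atlas c -> atlas d ->
    Cinfty (c @` (cdom c `&` cdom d)) (d \o cinv c)
}.

Record chart_at (R : realType) (H : hilbertType R) (M : hilbertManifold H)
    (p : M) := ChartAt {
  chart_of :> chart M H;
  chart_of_atlas : atlas chart_of;
  chart_of_dom : cdom chart_of p
}.

Section TangentSpace.
Context {R : realType} {H : hilbertType R} {M : hilbertManifold H} (p : M).

(* A tangent vector is the class of the triples (U, c, h), with (U, c) a chart
   at [p] and h in [H], for the relation identifying (U, c, h) with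
   (V, d, D(d o c^-1)(c p) h). Such a class contains exactly one triple for each
   chart at [p], i.e. it is a function from the charts at [p] to [H]. *)
Definition tangent_pred : {pred chart_at p -> H} :=
  [pred v : chart_at p -> H |
    `[< forall c d : chart_at p, v d = 'd (d \o cinv c) (c p) (v c) >]].

Record tangent := Tangent {
  coord :> chart_at p -> H;
  coordP : coord \in tangent_pred
}.

HB.instance Definition _ := [isSub for coord].
HB.instance Definition _ := [Choice of tangent by <:].

Fact tangent_submod_closed : submod_closed tangent_pred.
Proof.
split=> [|a v w].
  by apply/asboolP => c d; rewrite [LHS]/= [in RHS]/= linear0.
move=> /asboolP vP /asboolP wP; apply/asboolP => c d.
rewrite (_ : a *: v + w = fun c => a *: v c + w c)//.
by rewrite linearP -vP -wP.
Qed.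
HB.instance Definition _ := GRing.isSubmodClosed.Build R (chart_at p -> H)
  tangent_pred tangent_submod_closed.
HB.instance Definition _ := [SubChoice_isSubLmodule of tangent by <:].

End TangentSpace.
Arguments tangent_pred {R H} M p.
Arguments tangent {R H} M p.

Record riemannianManifold (R : realType) (H : hilbertType R) :=
    RiemannianManifold {
  riemannian_sort :> hilbertManifold H;
  metric : forall p, {dot tangent riemannian_sort p for idfun};
  metric_equiv : forall p (c : chart_at p), exists a b : R,
    [/\ 0 < a, 0 < b & forall v : tangent riemannian_sort p,
      a * `|v c| <= dot_norm (metric p) v <= b * `|v c|];
  (* in a chart the metric is a smooth map to the space of continuous bilinear
     forms, the latter identified with L(H, L(H, R)) *)
  metric_smooth : forall c, atlas c -> exists G : H -> clin H (clin H R),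
    Cinfty (cimg c) G /\
    forall p (cp : chart_at p), chart_of cp = c ->
      forall v w : tangent riemannian_sort p,
        metric p v w = G (c p) (v cp) (w cp)
}.

Section RiemannianTangent.
Context {R : realType} {H : hilbertType R} (M : riemannianManifold H) (p : M).

Definition rtangent : Type := tangent M p.

HB.instance Definition _ := GRing.Lmodule.on rtangent.

HB.instance Definition _ := Lmodule_isNormed.Build R rtangent
  (@ler_dot_normD _ _ (metric p)) (@dot_normZ _ _ (metric p))
  (@dot_norm0_eq0 _ _ (metric p)).

Definition cotangent : Type := clin rtangent R.

HB.instance Definition _ := NormedModule.on cotangent.

End RiemannianTangent.
Arguments rtangent {R H} M p.
Arguments cotangent {R H} M p.

Section Subdifferentials.
Context {R : realType} {H : hilbertType R} {M : riemannianManifold H}.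
Implicit Types (f : M -> \bar R) (phi : M -> R) (p : M).

Definition C1 phi : Prop := forall c, atlas c -> Ck 1 (cimg c) (phi \o cinv c).

(* The condition on the differentials read in two charts at [p] is the same, by
   the chain rule and the definition of tangent vectors; so for [phi] of class
   C^1 there is exactly one such [xi]. *)
Definition is_differential phi p (xi : cotangent M p) : Prop :=
  forall (c : chart_at p) (v : tangent M p),
    xi v = 'd (phi \o cinv c) (c p) (v c).

Local Open Scope ereal_scope.

Definition local_min f p : Prop := \forall x \near p, f p <= f x.
Definition local_max f p : Prop := \forall x \near p, f x <= f p.

Definition subdiff f p : set (cotangent M p) :=
  [set xi | f p < +oo /\ exists phi, [/\ C1 phi, is_differential phi xi &
    local_min (fun x => f x - (phi x)%:E) p]].

Definition superdiff f p : set (cotangent M p) :=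
  [set xi | f p < +oo /\ exists phi, [/\ C1 phi, is_differential phi xi &
    local_max (fun x => f x - (phi x)%:E) p]].

End Subdifferentials.
Arguments is_differential {R H M} phi p xi.
Arguments subdiff {R H M} f p.
Arguments superdiff {R H M} f p.

Definition minkowski_sum {V : nmodType} (A B : set V) : set V :=
  [set (a + b)%R | a in A & b in B].

(* Main.v *)
Require Import Defs.
From mathcomp Require Import all_boot all_order all_algebra.
From mathcomp Require Import all_classical all_reals all_analysis.

Set Implicit Arguments.
Unset Strict Implicit.

Import GRing.Theory.
Import numFieldNormedType.Exports.

Local Open Scope classical_set_scope.
Local Open Scope ring_scope.

(** Test functions add up. If f1 - phi1 and f2 - phi2 are both minimal at p near
    p, then adding the two inequalities shows that
    (f1 + f2) - (phi1 + phi2) is minimal at p near p ([local_minD]); the sum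
    phi1 + phi2 is again of class C^1 ([C1D]) and its differential is the sum of
    the two differentials ([is_differentialD]). The same argument with reversed
    inequalities gives the statement on superdifferentials.

    The values +oo do no harm: a sum of extended reals can be rearranged freely
    when no term is -oo, and subtracting the finite number phi x preserves this
    ([sub_addeACA]). *)

(** [fderiv] is a total function with a default value; differentiability puts
    it on its meaningful branch. *)
Lemma fderivE (R : realType) (E F : normedModType R) (f : E -> F) (x : E) :
  differentiable f x -> clin_fun (fderiv f x) = 'd f x :> (E -> F).
Proof.
move=> df; apply: insubdK; apply/asboolP; split.
  by move=> a u v; rewrite linearP.
exact: diff_continuous.
Qed.

Lemma fderivD (R : realType) (E F : normedModType R) (f g : E -> F) (x : E) :
  differentiable f x -> differentiable g x ->
  fderiv (f \+ g) x = fderiv f x + fderiv g x.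
Proof.
move=> df dg; apply: val_inj.
rewrite [LHS]fderivE ?diffD//; last exact: differentiableD.
by rewrite raddfD /= !fderivE.
Qed.

(** Openness of [U] matters: differentiability, hence additivity of [fderiv], is
    given on [U] only, while continuity of [fderiv] at a point of [U] involves a
    whole neighbourhood of this point. *)
Lemma Ck1D (R : realType) (E F : normedModType R) (U : set E) (f g : E -> F) :
  open U -> Ck 1 U f -> Ck 1 U g -> Ck 1 U (f \+ g).
Proof.
move=> oU [df cf] [dg cg]; split=> x Ux.
  by apply: differentiableD; [exact: df|exact: dg].
rewrite /prop_for /continuous_at fderivD; [|exact: df|exact: dg].
have fgD : \forall y \near x, (fderiv f + fderiv g) y = fderiv (f \+ g) y.
  apply: filterS (open_nbhs_nbhs (conj oU Ux)) => y Uy.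
  by rewrite fderivD; [|exact: df|exact: dg].
apply: cvg_trans (near_eq_cvg fgD) _.
by apply: cvgD; [exact: cf|exact: cg].
Qed.

Lemma C1D (R : realType) (H : hilbertType R) (M : riemannianManifold H)
    (phi psi : M -> R) : C1 phi -> C1 psi -> C1 (phi \+ psi).
Proof.
move=> Cphi Cpsi c ac.
by apply: Ck1D; [exact: cimg_open|exact: Cphi|exact: Cpsi].
Qed.

(** The C^1 hypotheses provide the differentiability at the image of [p] in each
    chart, without which 'd need not be additive. *)
Lemma is_differentialD (R : realType) (H : hilbertType R)
    (M : riemannianManifold H) (phi psi : M -> R) (p : M)
    (xi zeta : cotangent M p) :
  C1 phi -> C1 psi -> is_differential phi p xi -> is_differential psi p zeta ->
  is_differential (phi \+ psi) p (xi + zeta).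
Proof.
move=> Cphi Cpsi dxi dzeta c v.
have cp : cimg c (c p) by apply: cmap_fun; exact: chart_of_dom.
have [dphi _] := Cphi _ (chart_of_atlas c).
have [dpsi _] := Cpsi _ (chart_of_atlas c).
have := diffD (dphi _ cp) (dpsi _ cp) => /(congr1 (@^~ (v c))) /= dD.
rewrite [LHS](_ : _ = xi v + zeta v)// (dxi c) (dzeta c).
exact/esym.
Qed.

Lemma sub_addeACA (R : realType) (x y : \bar R) (a b : R) :
  (-oo < x -> -oo < y ->
   x + y - (a + b)%:E = (x - a%:E) + (y - b%:E))%E.
Proof.
case: x y => [x| |] [y| |] // _ _.
by rewrite -?EFinB -?EFinD opprD addrACA.
Qed.

Lemma local_minD (R : realType) (H : hilbertType R) (M : riemannianManifold H)
    (f1 f2 : M -> \bar R) (phi1 phi2 : M -> R) (p : M) :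
  (forall x, -oo < f1 x)%E -> (forall x, -oo < f2 x)%E ->
  local_min (fun x => f1 x - (phi1 x)%:E)%E p ->
  local_min (fun x => f2 x - (phi2 x)%:E)%E p ->
  local_min (fun x => f1 x + f2 x - ((phi1 \+ phi2)%R x)%:E)%E p.
Proof.
move=> hf1 hf2; apply: filterS2 => x min1 min2.
by rewrite !sub_addeACA//; exact: leeD.
Qed.

Lemma local_maxD (R : realType) (H : hilbertType R) (M : riemannianManifold H)
    (f1 f2 : M -> \bar R) (phi1 phi2 : M -> R) (p : M) :
  (forall x, -oo < f1 x)%E -> (forall x, -oo < f2 x)%E ->
  local_max (fun x => f1 x - (phi1 x)%:E)%E p ->
  local_max (fun x => f2 x - (phi2 x)%:E)%E p ->
  local_max (fun x => f1 x + f2 x - ((phi1 \+ phi2)%R x)%:E)%E p.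
Proof.
move=> hf1 hf2; apply: filterS2 => x max1 max2.
by rewrite !sub_addeACA//; exact: leeD.
Qed.

Theorem proposition4p12 (R : realType) (H : hilbertType R)
    (M : riemannianManifold H) (f1 f2 : M -> \bar R)
    (hf1 : forall x : M, (-oo < f1 x)%E) (hf2 : forall x : M, (-oo < f2 x)%E)
    (p : M) :
  minkowski_sum (subdiff f1 p) (subdiff f2 p)
    `<=` subdiff (fun x => f1 x + f2 x)%E p /\
  minkowski_sum (superdiff f1 p) (superdiff f2 p)
    `<=` superdiff (fun x => f1 x + f2 x)%E p.
Proof.
split=> _ [xi1 [fin1 [phi1 [C1 d1 ext1]]] [xi2 [fin2 [phi2 [C2 d2 ext2]]] <-]];
  (split; first exact: lte_add_pinfty); exists (phi1 \+ phi2); split.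
- exact: C1D.
- exact: is_differentialD.
- exact: local_minD.
- exact: C1D.
- exact: is_differentialD.
- exact: local_maxD.
Qed.
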